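(* Let $\mathbb{K}$ be an infinite field. Suppose that $T \in \mathbb{K}^{m \times n \times p}$ has a matrix-vector decomposition $T=\sum_{\ell=1}^q M_{\ell} \otimes w_{\ell}$ where the linear spaces $\operatorname{Im}(M_1),\dots,\operatorname{Im}(M_q)$ are in direct sum and the linear spaces $\operatorname{Im}(M_1^T),\dots,\operatorname{Im}(M_q^T)$ are in direct sum. Consider the following procedure with parameters $a,b\in\mathbb{K}^p$: (1) form $T_a$ and $T_b$; (2) compute $r=\operatorname{rank}(T_a)$ and choose an $r\times r$ submatrix $M_a$ of $T_a$ of rank $r$; (3) let $M_b$ be the submatrix of $T_b$ formed by the same rows and columns, and $P(\lambda)=\det(M_a-\lambda M_b)$; (4) compute the roots $\lambda_1,\dots,\lambda_{q'}$ of $P$ in $\mathbb{K}$; (5) compute $V_j=\ker(T_a-\lambda_jT_b)$ for $j=1,\dots,q'$; (6) output $T_b(V_1),\dots,T_b(V_{q'})$. Then for a generic choice of $(a,b)\in\mathbb{K}^p\times\mathbb{K}^p$, the output consists exactly of the linear spaces $\operatorname{Im}(M_1),\ldots,\operatorname{Im}(M_q)$ (in some order; in particular $q'=q$).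
   Context: The 3-slices of $T$ are $Z_k\in M_{m,n}(\mathbb{K})$ with $(Z_k)_{ij}=T_{ijk}$; for $c\in\mathbb{K}^p$, $T_c=\sum_{k=1}^pc_kZ_k$. For $M\in M_{m,n}(\mathbb{K})$, $w\in\mathbb{K}^p$, $M\otimes w$ has entries $M_{ij}w_k$. A matrix-vector decomposition of $T$ is an expression $T=\sum_\ell M_\ell\otimes w_\ell$ with all $M_\ell,w_\ell$ nonzero and no two $w_\ell$ colinear. A property holds for generic $x\in\mathbb{K}^N$ if there is a nonzero polynomial $P$ in $N$ variables such that the property holds whenever $P(x)\neq0$. *)

(* Defs.v *)
From HB Require Import structures.
From mathcomp Require Import all_boot all_order all_algebra.
From mathcomp Require Import mpoly.

Set Implicit Arguments.
Unset Strict Implicit.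
Unset Printing Implicit Defensive.

Import GRing.Theory.

Local Open Scope ring_scope.

Definition infinite_type (T : eqType) : Prop :=
  forall s : seq T, exists x, x \notin s.

Definition generic (K : fieldType) (N : nat) (Q : 'rV[K]_N -> Prop) : Prop :=
  exists2 P : {mpoly K[N]}, P != 0 & forall x : 'rV_N, P.@[x 0] != 0 -> Q x.

Notation tensor K m n p := {ffun 'I_m * 'I_n * 'I_p -> K}.

Definition slice (K : fieldType) (m n p : nat) (T : tensor K m n p)
  (k : 'I_p) : 'M[K]_(m, n) := \matrix_(i, j) T (i, j, k).

Definition contract (K : fieldType) (m n p : nat) (T : tensor K m n p)
  (c : 'rV[K]_p) : 'M[K]_(m, n) := \sum_(k < p) c 0 k *: slice T k.

Definition mvtensor (K : fieldType) (m n p : nat) (M : 'M[K]_(m, n))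
  (w : 'rV[K]_p) : tensor K m n p :=
  [ffun t => M t.1.1 t.1.2 * w 0 t.2].

Definition colinear (K : fieldType) (p : nat) (u v : 'rV[K]_p) : Prop :=
  exists c d : K, (c, d) <> (0, 0) /\ c *: u = d *: v.

Definition mv_decomposition (K : fieldType) (m n p q : nat)
  (T : tensor K m n p) (M : 'I_q -> 'M[K]_(m, n)) (w : 'I_q -> 'rV[K]_p) :
  Prop :=
  [/\ T = \sum_(l < q) mvtensor (M l) (w l),
      forall l, M l != 0,
      forall l, w l != 0 &
      forall l l', l != l' -> ~ colinear (w l) (w l')].

(* Matrices act on column vectors, by left multiplication. *)
Definition mxhom (K : fieldType) (m n : nat) (A : 'M[K]_(m, n)) :
  'Hom('cV[K]_n, 'cV[K]_m) := linfun (mulmx A).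

Definition mxIm (K : fieldType) (m n : nat) (A : 'M[K]_(m, n)) :
  {vspace 'cV[K]_m} := limg (mxhom A).

Definition mxKer (K : fieldType) (m n : nat) (A : 'M[K]_(m, n)) :
  {vspace 'cV[K]_n} := lker (mxhom A).

(* The maps f and g list, in increasing order, the rows and columns of an
   r x r submatrix of A that has rank r = \rank A. *)
Definition full_rank_choice (K : fieldType) (m n : nat) (A : 'M[K]_(m, n))
  (f : 'I_(\rank A) -> 'I_m) (g : 'I_(\rank A) -> 'I_n) : Prop :=
  [/\ {homo f : i j / (i < j)%N},
      {homo g : i j / (i < j)%N} &
      \rank (mxsub f g A) = \rank A].

Definition pencil_poly (K : fieldType) (r : nat) (A B : 'M[K]_r) : {poly K} :=
  \det (map_mx polyC A - 'X *: map_mx polyC B).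

Definition lists_roots (K : fieldType) (P : {poly K}) (s : seq K) : Prop :=
  uniq s /\ forall x, (x \in s) = root P x.

(* The result of the procedure for a given choice (f, g) of submatrix of T_a.
   If the polynomial has infinitely many roots there is no result; otherwise
   the result is unique up to the order in which the roots are listed. *)
Definition procedure_output (K : fieldType) (m n p : nat)
  (T : tensor K m n p) (a b : 'rV[K]_p)
  (f : 'I_(\rank (contract T a)) -> 'I_m)
  (g : 'I_(\rank (contract T a)) -> 'I_n)
  (out : seq {vspace 'cV[K]_m}) : Prop :=
  let Ta := contract T a in
  let Tb := contract T b in
  exists2 lam : seq K,
    lists_roots (pencil_poly (mxsub f g Ta) (mxsub f g Tb)) lam &
    out = [seq (mxhom Tb @: mxKer (Ta - x *: Tb))%VS | x <- lam].

(* Whichever submatrix is chosen, a result exists, and every result is the list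
   of the spaces U_l, up to order. *)
Definition procedure_recovers (K : fieldType) (m n p q : nat)
  (T : tensor K m n p) (a b : 'rV[K]_p) (U : 'I_q -> {vspace 'cV[K]_m}) :
  Prop :=
  (exists f g, full_rank_choice (A := contract T a) f g) /\
  forall f g, full_rank_choice (A := contract T a) f g ->
    (exists out, procedure_output b f g out) /\
    forall out, procedure_output b f g out ->
      perm_eq out [seq U l | l <- enum 'I_q].

(* Main.v *)
(** Writing [x_l = <w_l, a>] and [y_l = <w_l, b>], we have
    [T_a - z T_b = \sum_l (x_l - z y_l) M_l].  Directness of the images and of
    the images of the transposes yields matrices [E_l], [F_l] with
    [E_l M_k = M_k F_l = M_l] if [k = l] and [0] otherwise.  When no [x_l] is
    zero, they let one recover the row and column spaces of any
    [\sum_l d_l M_l] from those of [T_a], so all the relations among the rows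
    and columns of [T_a] persist; hence the chosen minor of [T_a - z T_b] is
    singular exactly when some [x_l - z y_l] vanishes.  At [z = x_l / y_l] only
    the term [l] vanishes, and [E_k], [F_l] show that [T_b] maps the kernel onto
    [Im(M_l)].  The polynomial that describes genericity is the product of all
    [x_l y_l] and of all [x_l y_k - x_k y_l], [k <> l]. *)

Require Import Defs.
From HB Require Import structures.
From mathcomp Require Import all_boot all_order all_algebra.
From mathcomp Require Import mpoly.

Set Implicit Arguments.
Unset Strict Implicit.
Unset Printing Implicit Defensive.

Import GRing.Theory.

Local Open Scope ring_scope.

(** * Projections of a direct sum and the separating matrices *)

(** The components of [v] and the family equal to [v] at [j] and to 0 elsewhere have the same sum;
    independence makes their differences vanish. *)
Lemma sumv_pi_directE (K : fieldType) (vT : vectType K) (I : finType)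
    (V : I -> {vspace vT}) (i j : I) (v : vT) :
  directv (\sum_i V i)%VS -> v \in V j ->
  sumv_pi_for (erefl (\sum_i V i)%VS) i v = if i == j then v else 0.
Proof.
move=> /directv_sum_independent dV vVj; apply/eqP; rewrite -subr_eq0; apply/eqP.
apply: (dV (fun k => sumv_pi_for (erefl (\sum_i V i)%VS) k v
                       - if k == j then v else 0)) => // [k _|].
  by apply: memvB; [apply: memv_sum_pi | case: eqP => [->|_] //; apply: mem0v].
rewrite sumrB sumv_pi_sum; last exact: (subvP (sumv_sup j _ (subvv _))).
by rewrite -big_mkcond big_pred1_eq subrr.
Qed.

Lemma eq_mulmx_col (K : fieldType) (m n : nat) (A B : 'M[K]_(m, n)) :
  (forall v : 'cV_n, A *m v = B *m v) -> A = B.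
Proof.
move=> eqAB; apply/matrixP=> i j.
by have /matrixP/(_ i 0) := eqAB (delta_mx j 0); rewrite -!colE !mxE.
Qed.

Lemma mem_mxIm (K : fieldType) (m n : nat) (A : 'M[K]_(m, n)) v :
  A *m v \in mxIm A.
Proof. by have := memv_img (mxhom A) (memvf v); rewrite lfunE. Qed.

Lemma mem_mxKer (K : fieldType) (m n : nat) (A : 'M[K]_(m, n)) v :
  (v \in mxKer A) = (A *m v == 0).
Proof. by rewrite memv_ker lfunE. Qed.

(** [E l] is the matrix, in the standard basis, of the projection to the summand [mxIm (M l)]. The
    identity is checked on the vectors [M k *m v]. *)
Lemma direct_mxIm_separation (K : fieldType) (m n q : nat)
    (M : 'I_q -> 'M[K]_(m, n)) :
  directv (\sum_(l < q) mxIm (M l))%VS ->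
  exists E : 'I_q -> 'M[K]_m,
    forall l k, E l *m M k = if l == k then M k else 0.
Proof.
move=> dM; pose f l := sumv_pi_for (erefl (\sum_(l < q) mxIm (M l))%VS) l.
exists (fun l => \matrix_(i, j) f l (delta_mx j 0) i 0) => l k.
have fE (v : 'cV_m) : (\matrix_(i, j) f l (delta_mx j 0) i 0) *m v = f l v.
  rewrite {2}(matrix_sum_delta v) linear_sum; apply/colP=> i.
  rewrite mxE summxE; apply: eq_bigr => j _.
  by rewrite big_ord1 linearZ !mxE mulrC.
apply: eq_mulmx_col => v.
rewrite -mulmxA fE (sumv_pi_directE _ dM (mem_mxIm _ _)).
by case: eqP; rewrite ?mul0mx.
Qed.

(** * Submatrices of full rank *)

Section RowChoice.

Variable K : fieldType.

(** [maxrankfun] selects independent rows, in an order that need not be increasing; enumerating the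
    set [S] of their indices sorts them. *)
Lemma increasing_rowsub (m n : nat) (A : 'M[K]_(m, n)) (r : nat) :
  \rank A = r ->
  exists2 f : 'I_r -> 'I_m,
    {homo f : i j / (i < j)%N} & \rank (rowsub f A) = r.
Proof.
move=> <-; set S := [set maxrankfun A i | i : 'I_(\rank A)].
have cS : #|S| = \rank A.
  by rewrite card_imset ?card_ord //; apply: maxrankfun_inj.
pose f (i : 'I_(\rank A)) : 'I_m := enum_val (cast_ord (esym cS) i).
exists f => [i j lt_ij|].
  have srt : sorted ltn (map val (enum S)).
    apply: (subseq_sorted ltn_trans (s2 := map val (enum 'I_m))).
      by rewrite map_subseq // enumT filter_subseq.
    by rewrite val_enum_ord iota_ltn_sorted.
  rewrite /f !(enum_val_nth (maxrankfun A i)).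
  have lt_enum (k : 'I_(\rank A)) : (k < size (enum S))%N by rewrite -cardE cS.
  rewrite -!(nth_map _ 0%N val) ?lt_enum //.
  by apply: (sorted_ltn_nth ltn_trans 0%N srt); rewrite ?inE ?size_map ?lt_enum.
(* Each row selected by [maxrankfun] is again a row of [rowsub f A], which gives the lower bound on
   the rank. *)
apply/eqP; rewrite eqn_leq rank_leq_row /= -{1}(eq_maxrowsub A) mxrankS //.
have memS i : maxrankfun A i \in S by apply: imset_f.
apply: (@submx_rowsub _ _ _ _ _
  (fun i => cast_ord cS (enum_rank_in (memS i) (maxrankfun A i)))).
by move=> i; rewrite /f /= cast_ordK enum_rankK_in.
Qed.

Lemma full_rank_choice_exists (m n : nat) (A : 'M[K]_(m, n)) :
  exists f g, full_rank_choice (A := A) f g.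
Proof.
have [f incf rkf] := increasing_rowsub (erefl (\rank A)).
have [|g incg rkg] := @increasing_rowsub _ _ (rowsub f A)^T (\rank A).
  by rewrite mxrank_tr.
exists f, g; split=> //; rewrite -[RHS]rkg -mxrank_tr; congr (\rank _).
by apply/matrixP=> i j; rewrite !mxE.
Qed.

Lemma rowsub_rank_span (m n r : nat) (A : 'M[K]_(m, n)) (f : 'I_r -> 'I_m) :
  (\rank A <= \rank (rowsub f A))%N -> exists Y, A = Y *m rowsub f A.
Proof.
move=> rkA; apply/submxP; rewrite -(geq_leqif (mxrank_leqif_sup (rowsub_sub f A))).
exact: rkA.
Qed.

Lemma rank_mxsub_rowsub (m n r s : nat) (A : 'M[K]_(m, n)) (f : 'I_r -> 'I_m)
    (g : 'I_s -> 'I_n) :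
  (\rank (mxsub f g A) <= \rank (rowsub f A))%N.
Proof.
have -> : mxsub f g A = rowsub f A *m colsub g 1%:M.
  by rewrite -mxsub_mul mulmx1.
exact: mxrankM_maxl.
Qed.

Lemma rank_mxsub_le (m n r s : nat) (A : 'M[K]_(m, n)) (f : 'I_r -> 'I_m)
    (g : 'I_s -> 'I_n) :
  (\rank (mxsub f g A) <= \rank A)%N.
Proof.
by rewrite (leq_trans (rank_mxsub_rowsub A f g)) // mxrankS // rowsub_sub.
Qed.

(* The relations among the rows of [A] hold among those of [B = A *m F], and
   those among its columns hold among those of [B = E *m A]. *)
Lemma rank_mxsub_transfer (m n r : nat) (A B : 'M[K]_(m, n)) (E : 'M_m)
    (F : 'M_n) (f : 'I_r -> 'I_m) (g : 'I_r -> 'I_n) :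
  \rank (mxsub f g A) = \rank A -> B = E *m A -> B = A *m F ->
  (\rank B <= \rank (mxsub f g B))%N.
Proof.
move=> rkA BE BF.
have [|Y AY] := @rowsub_rank_span _ _ _ A f.
  by rewrite -rkA rank_mxsub_rowsub.
have [|Z AZ] := @rowsub_rank_span _ _ _ A^T g.
  by rewrite mxrank_tr -rkA -mxrank_tr trmx_mxsub rank_mxsub_rowsub.
have {}AZ : A = colsub g A *m Z^T.
  by rewrite -[LHS]trmxK AZ trmx_mul trmx_mxsub trmxK.
have BY : B = Y *m rowsub f B by rewrite BF -mul_rowsub_mx mulmxA -AY.
have BZ : B = colsub g B *m Z^T by rewrite BE -mulmx_colsub -mulmxA -AZ.
(* [B] factors through its submatrix, with coefficients [Y] and [Z] taken from the relations of
   [A]. *)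
have -> : \rank B = \rank (Y *m (mxsub f g B *m Z^T)).
  congr (\rank _); rewrite {1}BY; congr (_ *m _).
  rewrite {1}BZ -mul_rowsub_mx; congr (_ *m _).
  by apply/matrixP=> i j; rewrite !mxE.
exact: leq_trans (mxrankM_maxr _ _) (mxrankM_maxl _ _).
Qed.

End RowChoice.

(** * Roots and kernels of a pencil of separated matrices *)

Lemma pencil_polyE (K : fieldType) (r : nat) (A B : 'M[K]_r) x :
  (pencil_poly A B).[x] = \det (A - x *: B).
Proof.
rewrite -horner_evalE /pencil_poly -det_map_mx; congr (\det _).
by apply/matrixP=> i j; rewrite !mxE /= horner_evalE !hornerE.
Qed.

Section SeparatedPencil.

Variables (K : fieldType) (m n q : nat) (M : 'I_q -> 'M[K]_(m, n)).
Variables (E : 'I_q -> 'M[K]_m) (F : 'I_q -> 'M[K]_n).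
Hypothesis EM : forall l k, E l *m M k = if l == k then M k else 0.
Hypothesis MF : forall l k, M k *m F l = if l == k then M k else 0.
Hypothesis M_neq0 : forall l, M l != 0.

Let comb (c : 'I_q -> K) := \sum_l c l *: M l.

Let E_comb c l : E l *m comb c = c l *: M l.
Proof.
rewrite mulmx_sumr (bigD1 l) //= big1 => [|k nkl].
  by rewrite addr0 -scalemxAr EM eqxx.
by rewrite -scalemxAr EM eq_sym (negPf nkl) scaler0.
Qed.

Let comb_F c l : comb c *m F l = c l *: M l.
Proof.
rewrite mulmx_suml (bigD1 l) //= big1 => [|k nkl].
  by rewrite addr0 -scalemxAl MF eqxx.
by rewrite -scalemxAl MF eq_sym (negPf nkl) scaler0.
Qed.

Let comb_transferl c d : (forall l, c l != 0) ->
  comb d = (\sum_l (d l / c l) *: E l) *m comb c.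
Proof.
move=> c0; rewrite mulmx_suml; apply: eq_bigr => l _.
by rewrite -scalemxAl E_comb scalerA divfK.
Qed.

Let comb_transferr c d : (forall l, c l != 0) ->
  comb d = comb c *m (\sum_l (d l / c l) *: F l).
Proof.
move=> c0; rewrite mulmx_sumr; apply: eq_bigr => l _.
by rewrite -scalemxAr comb_F scalerA divfK.
Qed.

Let rank_comb_le c d : (forall l, c l != 0) -> (\rank (comb d) <= \rank (comb c))%N.
Proof. by move=> c0; rewrite (comb_transferl d c0) mxrankM_maxr. Qed.

(** With equal ranks the row spaces would agree, so [comb c] would be a left multiple of [comb d];
    multiplying by [F l] on the right would then give [c l *: M l = 0]. *)
Let rank_comb_lt c d l : (forall l, c l != 0) -> d l = 0 ->
  (\rank (comb d) < \rank (comb c))%N.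
Proof.
move=> c0 dl; rewrite ltn_neqAle rank_comb_le // andbT; apply/negP => /eqP eqr.
have /submxP[Z cdZ] : (comb c <= comb d)%MS.
  rewrite -(geq_leqif (mxrank_leqif_sup _)) ?eqr //.
  by rewrite (comb_transferl d c0) submxMl.
have := comb_F c l; rewrite cdZ -mulmxA comb_F dl scale0r mulmx0 => /esym/eqP.
by rewrite scaler_eq0 (negPf (c0 l)) (negPf (M_neq0 l)).
Qed.

Variables x y : 'I_q -> K.
Hypothesis x_neq0 : forall l, x l != 0.
Hypothesis y_neq0 : forall l, y l != 0.
Hypothesis xy_neq0 : forall l k, l != k -> x l * y k - x k * y l != 0.

Let comb_pencil z : comb x - z *: comb y = comb (fun l => x l - z * y l).
Proof.
rewrite scaler_sumr -sumrB; apply: eq_bigr => l _.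
by rewrite scalerA scalerBl.
Qed.

Let ratio l := x l / y l.

Let ratio_root l : x l - ratio l * y l = 0.
Proof. by rewrite divfK ?subrr. Qed.

Let ratio_neq l k : l != k -> x k - ratio l * y k != 0.
Proof.
move=> nlk; apply: contra (xy_neq0 nlk) .
rewrite !subr_eq0 => /eqP->.
by rewrite mulrAC divfK.
Qed.

Let ratio_inj : injective ratio.
Proof.
move=> l k eq_lk; apply/eqP/negPn/negP => /ratio_neq.
by rewrite eq_lk ratio_root eqxx.
Qed.

Lemma root_pencil r (f : 'I_r -> 'I_m) (g : 'I_r -> 'I_n) z :
  r = \rank (comb x) -> \rank (mxsub f g (comb x)) = r ->
  root (pencil_poly (mxsub f g (comb x)) (mxsub f g (comb y))) z
    = (z \in codom ratio).
Proof.
move=> rE rkx; rewrite rootE pencil_polyE.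
have -> : mxsub f g (comb x) - z *: mxsub f g (comb y)
    = mxsub f g (comb (fun l => x l - z * y l)).
  by rewrite -comb_pencil; apply/matrixP=> i j; rewrite !mxE.
set d := fun l => _; apply/idP/codomP => [detd0|[l zE]].
  have [/existsP[l /eqP zl]|/existsPn nz] := boolP [exists l, z == ratio l].
    by exists l.
  have d0 l : d l != 0.
    apply: contra (nz l); rewrite subr_eq0 => /eqP xE.
    by rewrite /ratio xE mulfK.
  move: detd0; rewrite -[_ == 0]negbK -unitfE -unitmxE -row_free_unit => /negP[].
  (* All coefficients [d l] are nonzero, so the pencil has at least the rank of [comb x], and the
     submatrix inherits this bound. *)
  rewrite -row_leq_rank.
  apply: leq_trans (rank_mxsub_transfer _ (comb_transferl d x_neq0)
                      (comb_transferr d x_neq0)); last by rewrite rkx.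
  by rewrite {1}rE rank_comb_le.
(* At a ratio one coefficient vanishes, so the whole pencil, and with it the submatrix, has rank
   below [r]. *)
apply: contraT; rewrite -unitfE -unitmxE -row_free_unit -row_leq_rank {1}rE.
move=> /leq_trans/(_ (rank_mxsub_le _ _ _)).
by rewrite leqNgt (@rank_comb_lt _ _ l) // /d zE ratio_root.
Qed.

Lemma img_ker_pencil l :
  (mxhom (comb y) @: mxKer (comb x - ratio l *: comb y))%VS = mxIm (M l).
Proof.
rewrite comb_pencil; apply: subv_anti; apply/andP; split; apply/subvP => u.
  case/memv_imgP=> v; rewrite mem_mxKer lfunE /= => /eqP kv ->.
  suff -> : comb y *m v = M l *m (y l *: v) by apply: mem_mxIm.
  rewrite mulmx_suml (bigD1 l) //= big1 => [|k nkl].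
    by rewrite addr0 -scalemxAl -scalemxAr.
  (* Applying [E k] to the kernel equation isolates its term [k], whose coefficient is nonzero;
     hence [M k *m v = 0] for [k != l]. *)
  have /eqP : E k *m (comb (fun k => x k - ratio l * y k) *m v) = 0.
    by rewrite kv mulmx0.
  rewrite mulmxA E_comb -!scalemxAl scaler_eq0.
  rewrite eq_sym in nkl.
  by rewrite (negPf (ratio_neq nkl)) => /eqP->; rewrite scaler0.
case/memv_imgP=> v _; rewrite lfunE /= => ->.
(* [F l] reduces [comb y] to [y l *: M l], whence the factor [(y l)^-1]; it reduces the pencil to
   its vanishing term [l], so this preimage lies in the kernel. *)
have -> : M l *m v = mxhom (comb y) (F l *m ((y l)^-1 *: v)).
  rewrite lfunE /= mulmxA comb_F -scalemxAl -scalemxAr scalerA.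
  by rewrite divff // scale1r.
apply: memv_img; rewrite mem_mxKer mulmxA comb_F ratio_root scale0r.
by rewrite mul0mx.
Qed.

Lemma recovers_of_separated p (T : tensor K m n p) (a b : 'rV[K]_p) :
  contract T a = comb x -> contract T b = comb y ->
  procedure_recovers T a b (fun l => mxIm (M l)).
Proof.
move=> Ta Tb; split; first exact: full_rank_choice_exists.
move=> f g [_ _ rkfg].
have rootE z : root (pencil_poly (mxsub f g (contract T a))
    (mxsub f g (contract T b))) z = (z \in codom ratio).
  (* The types of [f] and [g] mention [contract T a], so both are generalized before rewriting. *)
  move: f g rkfg; rewrite Tb Ta => f g rkfg.
  exact: root_pencil.
have outE : [seq mxIm (M l) | l <- enum 'I_q] =
    [seq (mxhom (contract T b) @: mxKer (contract T a - z *: contract T b))%VS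
       | z <- codom ratio].
  rewrite /codom /image_mem -map_comp; apply: eq_map => l /=.
  by rewrite Ta Tb img_ker_pencil.
have uniq_ratio : uniq (codom ratio) by apply/injectiveP/ratio_inj.
split=> [|out [lam [uniq_lam lamE] ->]].
  by eexists; exists (codom ratio) => //; split=> // z; rewrite rootE.
rewrite outE; apply/perm_map/uniq_perm => // z.
by rewrite lamE rootE.
Qed.

End SeparatedPencil.

(** * Linear forms in the parameters and nonvanishing polynomials *)

(** Fix [i] with [u 0 i != 0]. If all minors on column [i] vanished, then [v 0 i *: u = u 0 i *: v]
    would be a nontrivial relation. *)
Lemma not_colinear_minor (K : fieldType) (p : nat) (u v : 'rV[K]_p) :
  u != 0 -> ~ colinear u v ->
  exists i j, u 0 i * v 0 j - v 0 i * u 0 j != 0.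
Proof.
move=> /rV0Pn[i ui0] ncol.
have [/existsP[j uv]|/existsPn uv] :=
  boolP [exists j, u 0 i * v 0 j - v 0 i * u 0 j != 0]; first by exists i, j.
case: ncol; exists (v 0 i), (u 0 i); split.
  by case=> _ ui; rewrite ui eqxx in ui0.
apply/rowP=> j; rewrite !mxE; apply/esym/eqP; rewrite -subr_eq0.
exact: negbNE (uv j).
Qed.

Lemma contract_mv (K : fieldType) (m n p q : nat) (M : 'I_q -> 'M[K]_(m, n))
    (w : 'I_q -> 'rV[K]_p) (c : 'rV[K]_p) :
  contract (\sum_(l < q) mvtensor (M l) (w l)) c
    = \sum_(l < q) (\sum_(k < p) w l 0 k * c 0 k) *: M l.
Proof.
apply/matrixP=> i j; rewrite !summxE.
under eq_bigr do rewrite !mxE sum_ffunE mulr_sumr.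
rewrite exchange_big; apply: eq_bigr => l _ /=.
rewrite !mxE mulr_suml; apply: eq_bigr => k _.
by rewrite ffunE /= mulrCA mulrC [c 0 k * _]mulrC.
Qed.

Section LinearForms.

Variables (K : fieldType) (p : nat).

(** The map [h] places the coordinates among the [N] variables: [lshift] gives the form in [a], and
    [rshift] the form in [b], within the joint variables of the pair. *)
Definition linform (N : nat) (h : 'I_p -> 'I_N) (w : 'rV[K]_p) : {mpoly K[N]} :=
  \sum_(k < p) w 0 k *: 'X_(h k).

Lemma meval_linform N (h : 'I_p -> 'I_N) w v :
  (linform h w).@[v] = \sum_(k < p) w 0 k * v (h k).
Proof.
by rewrite raddf_sum; apply: eq_bigr => k _; rewrite /= mevalZ mevalXU.
Qed.

Lemma meval_neq0 N (P : {mpoly K[N]}) v : P.@[v] != 0 -> P != 0.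
Proof. by apply: contraNneq => ->; rewrite meval0. Qed.

Let sum_delta (w : 'rV[K]_p) i :
  \sum_(k < p) w 0 k * (delta_mx 0 i : 'rV[K]_p) 0 k = w 0 i.
Proof.
rewrite (bigD1 i) //= big1 => [|k nki]; rewrite mxE ?eqxx ?mulr1 ?addr0 //.
by rewrite (negPf nki) mulr0.
Qed.

Lemma linform_neq0 N (h : 'I_p -> 'I_N) w : injective h -> w != 0 ->
  linform h w != 0.
Proof.
move=> inj_h /rV0Pn[i wi]; apply: (@meval_neq0 _ _ (fun k => (k == h i)%:R)).
rewrite meval_linform (bigD1 i) //= big1 => [|k nki].
  by rewrite eqxx mulr1 addr0.
by rewrite (inj_eq inj_h) (negPf nki) mulr0.
Qed.

Lemma linform_minor_neq0 (u v : 'rV[K]_p) : u != 0 -> ~ colinear u v ->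
  linform (@lshift p p) u * linform (@rshift p p) v
    - linform (@lshift p p) v * linform (@rshift p p) u != 0.
Proof.
move=> u0 /(not_colinear_minor u0)[i [j uv]].
(* At the pair of basis vectors [i] and [j] the polynomial takes the value of the nonzero minor. *)
pose e : 'rV[K]_(p + p) := row_mx (delta_mx 0 i) (delta_mx 0 j).
have evl z : (linform (@lshift p p) z).@[e 0] = z 0 i.
  by rewrite meval_linform -sum_delta; apply: eq_bigr => k _; rewrite row_mxEl.
have evr z : (linform (@rshift p p) z).@[e 0] = z 0 j.
  by rewrite meval_linform -sum_delta; apply: eq_bigr => k _; rewrite row_mxEr.
by apply: (@meval_neq0 _ _ (e 0)); rewrite mevalB !mevalM !evl !evr.
Qed.

End LinearForms.

Theorem theorem4p2 (K : fieldType) (m n p q : nat) (T : tensor K m n p)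
  (M : 'I_q -> 'M[K]_(m, n)) (w : 'I_q -> 'rV[K]_p) :
  infinite_type K ->
  mv_decomposition T M w ->
  directv (\sum_(l < q) mxIm (M l))%VS ->
  directv (\sum_(l < q) mxIm ((M l)^T))%VS ->
  generic (fun ab : 'rV[K]_(p + p) =>
    procedure_recovers T (lsubmx ab) (rsubmx ab) (fun l => mxIm (M l))).
Proof.
move=> _ [-> M0 w0 ncol] /direct_mxIm_separation[E EM].
move=> /direct_mxIm_separation[F FM].
pose X l := linform (@lshift p p) (w l); pose Y l := linform (@rshift p p) (w l).
exists (\prod_l (X l * Y l) * \prod_l \prod_(k | l != k) (X l * Y k - X k * Y l)).
  apply: mulf_neq0; apply/prodf_neq0 => l _.
    by rewrite mulf_neq0 ?linform_neq0 //; [apply: lshift_inj | apply: rshift_inj].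
  by apply/prodf_neq0 => k nlk; apply: linform_minor_neq0 (ncol _ _ nlk).
move=> ab; rewrite mevalM mulf_eq0 negb_or !rmorph_prod /=.
case/andP=> /prodf_neq0 XY0 /prodf_neq0 minor0.
have XE l : (X l).@[ab 0] = \sum_(k < p) w l 0 k * lsubmx ab 0 k.
  by rewrite meval_linform; apply: eq_bigr => k _; rewrite mxE.
have YE l : (Y l).@[ab 0] = \sum_(k < p) w l 0 k * rsubmx ab 0 k.
  by rewrite meval_linform; apply: eq_bigr => k _; rewrite mxE.
(* [F] separates the transposes from the left, so its transposes separate the [M l] from the
   right. *)
apply: (@recovers_of_separated _ _ _ _ M E (fun l => (F l)^T) _ _ _
  (fun l => (X l).@[ab 0]) (fun l => (Y l).@[ab 0])) => //.
- move=> l k; apply: trmx_inj; rewrite trmx_mul trmxK FM.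
  by case: eqP => // _; rewrite trmx0.
- by move=> l; apply: contraNneq (XY0 l isT) => X0; rewrite mevalM X0 mul0r.
- by move=> l; apply: contraNneq (XY0 l isT) => Y0; rewrite mevalM Y0 mulr0.
- move=> l k nlk; have := minor0 l isT; rewrite rmorph_prod /=.
  by move/prodf_neq0/(_ k nlk); rewrite mevalB !mevalM.
- by rewrite contract_mv; apply: eq_bigr => l _; rewrite XE.
- by rewrite contract_mv; apply: eq_bigr => l _; rewrite YE.
Qed.
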